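(* For any (non-empty) totally bounded set $F$ in a metric space with $\overline{\dim}_{\mathrm{B}}F=0$, we have $\dim_{\mathrm{A}}^\theta F = 0$ for all $\theta \in (0,1)$.
   Context: For a subset $E$ of a metric space and $r>0$, $N(E,r)$ denotes the minimal number of balls of radius $r$ required to cover $E$, and $B(x,R)$ is the ball of radius $R$ centred at $x$. For $\theta\in(0,1)$, the Assouad spectrum of $F$ at $\theta$ is \[ \dim_{\mathrm A}^{\theta} F = \inf\Big\{\alpha : \exists C>0,\ \exists \rho>0,\ \forall\, 0<R\leq\rho,\ \forall x\in F,\ N(B(x,R)\cap F,R^{1/\theta})\leq C \big(R/R^{1/\theta}\big)^{\alpha}\Big\}. \] The upper box dimension of a totally bounded set $F$ is $\overline{\dim}_{\mathrm B}F=\limsup_{R\to0}\frac{\log N(F,R)}{-\log R}$. *)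

(* Defs.v *)
From mathcomp Require Import all_boot all_order all_algebra.
From mathcomp Require Import all_classical all_reals all_analysis.

Set Implicit Arguments.
Unset Strict Implicit.
Unset Printing Implicit Defensive.

Import Order.TTheory GRing.Theory Num.Theory.
Import numFieldNormedType.Exports.

Local Open Scope classical_set_scope.
Local Open Scope ring_scope.

(* Balls are the open balls of the ambient metric space X; the centres of a
   cover of E need not lie in E. *)
Definition ball_coverable (R : realType) (X : metricType R)
    (E : set X) (r : R) (n : nat) : Prop :=
  exists c : 'I_n -> X, E `<=` \bigcup_i ball (c i) r.

Definition totally_bounded (R : realType) (X : metricType R)
    (E : set X) : Prop :=
  forall r : R, 0 < r -> exists n : nat, ball_coverable E r n.

(* An infimum of a set of natural numbers, hence a minimum; it is +oo exactly
   when no finite cover exists. *)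
Definition covering_number (R : realType) (X : metricType R)
    (E : set X) (r : R) : \bar R :=
  ereal_inf [set n%:R%:E | n in ball_coverable E r].

Definition upper_box_dim (R : realType) (X : metricType R)
    (F : set X) : \bar R :=
  limf_esup (fun r : R => lne (covering_number F r) / (- ln r)%:E)%E 0^'+.

Definition assouad_spectrum (R : realType) (X : metricType R)
    (theta : R) (F : set X) : \bar R :=
  ereal_inf [set alpha%:E | alpha in [set alpha : R |
    exists2 C : R, 0 < C &
    exists2 rho : R, 0 < rho &
    forall r : R, 0 < r <= rho -> forall x : X, F x ->
      (covering_number (ball x r `&` F) (r `^ theta^-1)
         <= (C * (r / r `^ theta^-1) `^ alpha)%:E)%E]].

(* Main.v *)
Require Import Defs.
From mathcomp Require Import all_boot all_order all_algebra.
From mathcomp Require Import all_classical all_reals all_analysis.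
From mathcomp Require Import ring lra.

Import Order.TTheory GRing.Theory Num.Theory.
Import numFieldNormedType.Exports.

Local Open Scope classical_set_scope.
Local Open Scope ring_scope.

(** The theorem is the case of box dimension zero of the general bound
    [dim_A^theta F <= dim_B F / (1 - theta)], together with
    [0 <= dim_A^theta F] for non-empty [F].

    The upper bound forgets the localisation: covering all of [F] at scale
    [r^(1/theta)] also covers each piece [ball x r `&` F].  If [dim_B F < s],
    then [F] needs at most [(r^(1/theta))^(-s)] balls for small [r], and this
    number is exactly [(r / r^(1/theta))^(s / (1 - theta))]
    ([assouad_spectrum_le]).  As [s] tends to [0], so does [s / (1 - theta)].

    For the lower bound, a piece centred at a point of [F] is non-empty and so
    needs at least one ball, whereas for [alpha < 0] the permitted number
    [C * (r / r^(1/theta))^alpha] tends to [0] with [r]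
    ([assouad_spectrum_ge0]). *)

Section CoveringNumber.
Context {R : realType} {X : metricType R}.
Implicit Types (E F : set X) (r s theta : R).

Lemma le_covering_number E F r :
  E `<=` F -> (covering_number E r <= covering_number F r)%E.
Proof.
move=> EF; apply: ereal_inf_le_tmp => _ [n [c Fc] <-].
by exists n => //; exists c; apply: subset_trans Fc.
Qed.

Lemma covering_number_ge1 E r : E !=set0 -> (1 <= covering_number E r)%E.
Proof.
move=> [x Ex]; apply: le_ereal_inf_tmp => _ [n [c Ec] <-].
have [i _ _] := Ec x Ex.
by rewrite lee_fin ler1n (leq_ltn_trans (leq0n i) (ltn_ord i)).
Qed.

(** Undoing the logarithms in the definition of the upper box dimension; the
    quotient there is monotone in the covering number because [- ln r] is
    positive for [r < 1]. *)
Lemma covering_number_near_le F s : (upper_box_dim F < s%:E)%E ->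
  \forall r \near 0^'+, (covering_number F r <= (r `^ (- s))%:E)%E.
Proof.
move=> /ereal_inf_lt[_ [V V0 <-]] supV; near=> r.
have r0 : 0 < r by near: r; exact: nbhs_right_gt.
have r1 : r < 1 by near: r; exact: nbhs_right_lt.
have Vr : V r by near: r.
have lnr : 0 < - ln r by rewrite oppr_gt0 ln_lt0 ?r0.
have : (lne (covering_number F r) / (- ln r)%:E < s%:E)%E.
  by apply: le_lt_trans supV; apply: ereal_sup_ubound; exists r.
rewrite inver gt_eqF//.
case: (covering_number F r) => [N| |] /=; last by rewrite leNye.
- case: ifPn => [N0 _|]; first by rewrite lee_fin (le_trans N0) ?powR_ge0.
  rewrite -ltNge -EFinM lte_fin lee_fin ltr_pdivrMr// => N0 lnN.
  rewrite -ler_ln ?posrE ?powR_gt0// ln_powR mulNr -mulrN.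
  exact: ltW.
- by rewrite gt0_mulye// lte_fin invr_gt0.
Unshelve. all: by end_near. Qed.

Lemma div_powRV r theta : 0 < r -> r / r `^ theta^-1 = r `^ (1 - theta^-1).
Proof.
by move=> r0; rewrite powRB ?powRr1 ?(ltW r0)// (gt_eqF r0) implybT.
Qed.

Lemma assouad_spectrum_le F s theta : 0 < theta < 1 ->
  (upper_box_dim F < s%:E)%E ->
  (assouad_spectrum theta F <= (s / (1 - theta))%:E)%E.
Proof.
move=> /andP[theta0 theta1] /covering_number_near_le[e /= e0 cov].
apply: ereal_inf_lbound; exists (s / (1 - theta)) => //=.
exists 1 => //.
(* any rho with [rho^(1/theta) < e] works *)
exists ((e / 2) `^ theta); first by rewrite powR_gt0// divr_gt0.
move=> r /andP[r0 rle] x _.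
have re : r `^ theta^-1 < e.
  have : r `^ theta^-1 <= ((e / 2) `^ theta) `^ theta^-1.
    apply: ge0_ler_powR => //; rewrite ?nnegrE ?powR_ge0 ?(ltW r0)//.
    by rewrite invr_ge0 ltW.
  by rewrite -powRrM divff ?gt_eqF// powRr1; lra.
apply: le_trans; first by apply: le_covering_number; exact: subIsetr.
have -> : 1 * (r / r `^ theta^-1) `^ (s / (1 - theta)) =
          (r `^ theta^-1) `^ (- s).
  rewrite mul1r div_powRV// -!powRrM; congr (_ `^ _).
  by field; apply/andP; split; lra.
apply: cov; last by rewrite powR_gt0.
by rewrite /ball_/= sub0r normrN ger0_norm ?powR_ge0.
Qed.

Lemma assouad_spectrum_ge0 F theta : 0 < theta < 1 -> F !=set0 ->
  (0 <= assouad_spectrum theta F)%E.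
Proof.
move=> /andP[theta0 theta1] [x Fx].
apply: le_ereal_inf_tmp => _ [alpha [C C0 [rho rho0 cov]] <-].
rewrite lee_fin leNgt; apply/negP => alpha0.
have p0 : 0 < (1 - theta^-1) * alpha.
  by rewrite nmulr_rgt0// subr_lt0 invf_gt1.
have [r [r0 rrho rC]] : exists r, [/\ 0 < r, r <= rho &
    r `^ ((1 - theta^-1) * alpha) < C^-1].
  apply: (@filter_ex _ (0 : R)^'+); near=> r; split; near: r.
  - exact: nbhs_right_gt.
  - exact: nbhs_right_ltW.
  - by apply: (cvgr_lt (0 : R)); [exact: powR_cvg0 | rewrite invr_gt0].
have := cov r _ x Fx; rewrite r0 rrho => /(_ isT).
apply/negP; rewrite -ltNge.
apply: (@lt_le_trans _ _ 1%E); last first.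
  by apply: covering_number_ge1; exists x; split=> //; exact: ballxx.
by rewrite lte_fin div_powRV// -powRrM mulrC -ltr_pdivlMr// div1r.
Unshelve. all: by end_near. Qed.

End CoveringNumber.

Theorem corollary3p3 (R : realType) (X : metricType R) (F : set X)
    (F_neq0 : F !=set0) (F_tb : totally_bounded F)
    (F_dim0 : upper_box_dim F = 0%E) :
  forall theta : R, 0 < theta < 1 -> assouad_spectrum theta F = 0%E.
Proof.
move=> theta theta01; apply/eqP; rewrite eq_le assouad_spectrum_ge0// andbT.
have theta1 : 0 < 1 - theta by case/andP: theta01; lra.
apply/lee_addgt0Pr => e e0; rewrite add0e.
have -> : e = (e * (1 - theta)) / (1 - theta) by rewrite mulfK// gt_eqF.
by apply: assouad_spectrum_le => //; rewrite F_dim0 lte_fin mulr_gt0.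
Qed.
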